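(* Consider the regression model $y_i=g(x_i)+\sqrt{V(x_i)}\,\epsilon_i$, $i=1,\dots,n$, as specified in the context. Fix $C_1>0$, $C_2>0$, $\beta>0$ and $\gamma>0$ defining the functional classes $\mathcal{C}_\gamma$ and $\mathcal{C}_\beta$. Assume that the $\epsilon_i$ are independent with $\epsilon_i\sim N(0,1)$. Let $x_0\in(0,1)$ be a fixed point. Then there is a constant $K>0$ (not depending on $n$) such that $$\inf_{\tilde V}\ \sup\{R(V(x_0),\tilde V(x_0)): V\in\mathcal{C}_\gamma,\ g\in\mathcal{C}_\beta\}\ \ge\ K\,n^{-2\gamma/(2\gamma+1)},$$ where the infimum is taken over all possible estimators $\tilde V$ of the variance function $V$.
   Context: Model: for each $n$ one observes $y_i=g(x_i)+\sqrt{V(x_i)}\,\epsilon_i$, $i=1,\dots,n$, where $g$ is an unknown mean function and $V\ge0$ an unknown variance function on $[0,1]$. The design points $x_1\le\dots\le x_n$ in $[0,1]$ are fixed (nonrandom, may depend on $n$), and when the endpoints $0$ and $1$ are added as the $0$th and $(n+1)$st design points, the maximal gap between consecutive design points is $O(n^{-1})$. (In the claim, $x_0$ denotes a fixed point of estimation in $(0,1)$, not the endpoint $0$.) Functional classes: for $\gamma>0$, $\lfloor\gamma\rfloor$ denotes the greatest integer strictly less than $\gamma$, and $\gamma'=\gamma-\lfloor\gamma\rfloor$. A function $f$ belongs to $\mathcal{C}_\gamma$ (depending on $C_1,C_2$) if for all $x,y\in(0,1)$, $|f^{(\lfloor\gamma\rfloor)}(x)-f^{(\lfloor\gamma\rfloor)}(y)|\le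 C_1|x-y|^{\gamma'}$ and $|f^{(k)}(x)|\le C_2$ for $k=0,\dots,\lfloor\gamma\rfloor-1$. $\mathcal{C}_\beta$ is defined in the same way with $\beta$ in place of $\gamma$. Variance functions $V$ are nonnegative. An estimator $\tilde V$ is any (measurable) function of the observations $y_1,\dots,y_n$ (and the known design). Pointwise risk: $R(V(x),\tilde V(x))=E[\tilde V(x)-V(x)]^2$.
   Formalization: For γ > 1 the design is also assumed to have O(1 + nh) points within distance h of x_0, for all n and h > 0; with only the O(1/n) gap bound the claim fails when half of the design points equal x_0. Nothing is added for γ ≤ 1. *)

(* Defs.v *)
From HB Require Import structures.
From mathcomp Require Import all_boot all_order all_algebra.
From mathcomp Require Import all_classical all_reals all_analysis.
Set Implicit Arguments.
Unset Strict Implicit.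
Unset Printing Implicit Defensive.
Import Order.TTheory GRing.Theory Num.Theory.
Import numFieldNormedType.Exports.
Local Open Scope classical_set_scope.
Local Open Scope ring_scope.

(* The greatest integer strictly less than a, so that 1 is sent to 0;
   characterized by strict_floorP. *)
Definition strict_floor (R : realType) (a : R) : nat := `|Num.ceil a|.-1.

Lemma strict_floorP (R : realType) (a : R) : 0 < a ->
  (strict_floor a)%:R < a <= (strict_floor a).+1%:R.
Proof.
move=> a0; have ca : 0 < Num.ceil a by rewrite ceil_gt0.
have [k ck] : exists k : nat, Num.ceil a = k.+1 :> int.
  by case: (Num.ceil a) ca => [[|k]|k] //= _; exists k.
rewrite /strict_floor ck /=; have := ceil_itv a.
by rewrite ck (_ : k.+1%:Z - 1 = k%:Z) // -addn1 PoszD addrK.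
Qed.

(* Functions on [0, 1] are represented by total functions on R.  Membership
   depends only on the values of f on the open interval, since derivatives at
   points of an open set are local; existence of the derivatives is required
   explicitly because derive1n is a total operator. *)
Definition smooth_class (R : realType) (C1 C2 gamma : R) : set (R -> R) :=
  [set f |
    [/\ (forall (k : nat) (x : R), (k < strict_floor gamma)%N -> 0 < x < 1 ->
           derivable (derive1n k f) x 1),
        (forall x y : R, 0 < x < 1 -> 0 < y < 1 ->
           `|derive1n (strict_floor gamma) f x - derive1n (strict_floor gamma) f y|
             <= C1 * `|x - y| `^ (gamma - (strict_floor gamma)%:R)) &
        (forall (k : nat) (x : R), (k < strict_floor gamma)%N -> 0 < x < 1 ->
           `|derive1n k f x| <= C2)]].

Definition parameter_space (R : realType) (C1 C2 gamma beta : R) :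
    set ((R -> R) * (R -> R)) :=
  [set Vg | [/\ smooth_class C1 C2 gamma Vg.1,
                (forall t, 0 <= t <= 1 -> 0 <= Vg.1 t) &
                smooth_class C1 C2 beta Vg.2]].

Definition is_design (R : realType) (n : nat) (x : 'I_n -> R) : Prop :=
  (forall i, 0 <= x i <= 1) /\ (forall i j : 'I_n, (i <= j)%N -> x i <= x j).

Definition extended_design (R : realType) (n : nat) (x : 'I_n -> R) : seq R :=
  0 :: rcons [seq x i | i <- enum 'I_n] 1.

Definition max_gap (R : realType) (n : nat) (x : 'I_n -> R) : R :=
  \big[Num.max/0]_(k < n.+1)
    ((extended_design x)`_k.+1 - (extended_design x)`_k).

(* An interval of radius h around x0 contains O(1 + n h) design points. This
   holds for instance when consecutive design points are at distance at least
   c / n for some c > 0.  A bound on the maximal gap does not imply it, since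
   it allows a positive fraction of the design points to be equal to x0. *)
Definition bounded_density_at (R : realType) (x : forall n, 'I_n -> R)
    (x0 : R) : Prop :=
  exists D : R, forall (n : nat) (h : R), 0 < h ->
    #|[pred i : 'I_n | `|x n i - x0| <= h]|%:R <= D * (1 + n%:R * h).

Definition mutually_independent d (T : measurableType d) (R : realType)
    (P : probability T R) (n : nat) (X : 'I_n -> {RV P >-> R}) : Prop :=
  forall (J : {set 'I_n}) (B : 'I_n -> set R),
    (forall i, measurable (B i)) ->
    P (\bigcap_(i in [set` J]) (X i @^-1` B i)) =
      (\prod_(i in J) P (X i @^-1` B i))%E.

Definition observations d (T : measurableType d) (R : realType)
    (P : probability T R) (n : nat) (x : 'I_n -> R)
    (eps : 'I_n -> {RV P >-> R}) (V g : R -> R) (w : T) : n.-tuple R :=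
  [tuple g (x i) + Num.sqrt (V (x i)) * eps i w | i < n].

(* The risk may be +oo, as the integrand is only nonnegative and measurable. *)
Definition pointwise_risk d (T : measurableType d) (R : realType)
    (P : probability T R) (n : nat) (x : 'I_n -> R)
    (eps : 'I_n -> {RV P >-> R}) (x0 : R) (V g : R -> R)
    (Vt : n.-tuple R -> R) : \bar R :=
  'E_P[fun w => (Vt (observations x eps V g w) - V x0) ^+ 2].

Definition minimax_risk d (T : measurableType d) (R : realType)
    (P : probability T R) (C1 C2 gamma beta : R) (n : nat) (x : 'I_n -> R)
    (eps : 'I_n -> {RV P >-> R}) (x0 : R) : \bar R :=
  ereal_inf
    [set ereal_sup [set pointwise_risk x eps x0 Vg.1 Vg.2 Vt
                   | Vg in parameter_space C1 C2 gamma beta]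
    | Vt in [set Vt : n.-tuple R -> R | measurable_fun [set: n.-tuple R] Vt]].

(* Main.v *)
Require Import Defs.
From HB Require Import structures.
From mathcomp Require Import all_boot all_order all_algebra.
From mathcomp Require Import all_classical all_reals all_analysis.
From mathcomp Require Import measurable_realfun.
From mathcomp Require Import ring lra.
Set Implicit Arguments.
Unset Strict Implicit.
Unset Printing Implicit Defensive.
Import Order.TTheory GRing.Theory Num.Theory.
Import numFieldNormedType.Exports.
Import HBNNSimple.
Local Open Scope classical_set_scope.
Local Open Scope ring_scope.

(** The bound comes from testing two variance functions against each other, with
    mean function 0: a constant c, and a function V that differs from c by delta
    at x0 but is hard to tell from c on the basis of n observations.  Under both
    hypotheses the observations are independent centred Gaussians.  If L is the
    likelihood ratio of the second law to the first, then for every estimator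
    the sum of the two risks is E[A^2 + L (A - delta)^2] under the first
    law, where A is the error in estimating c.  As
    A^2 + L (A - delta)^2 >= delta^2 L / (1 + L), this sum is bounded
    below by a multiple of delta^2 as soon as E[L^2] is bounded, E[L] being 1
    ([two_point_pointwise], [two_point_risk]).  By independence E[L^2] is a
    product; the factor of an observation with variance (1 + t) c is
    (1 - t^2)^(-1/2) ([integral_normal_lr_sqr]), so that E[L^2] <= 2 once the
    squares of the relative perturbations t sum to at most 1/2
    ([prod_chi_square_le2]).

    It remains to choose c and V in the class.

    If gamma > 1, the class bounds its members, and V is the constant C2 / 2 plus
    a bump of height a h^gamma and width h centred at x0, with
    h = n^(-1/(2 gamma + 1)).  For a small the bump keeps V in the class
    ([bumped_variance_smooth]).  At most D (1 + n h) design points see the bump,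
    so the relative perturbations have squares summing to at most a multiple of
    a^2 (1 + n h) h^(2 gamma), which is at most 2 a^2 since h <= 1 and
    n h^(2 gamma + 1) = 1 ([bandwidth_powers]).  The squared gap
    delta^2 = a^2 h^(2 gamma) is the announced rate.

    If gamma <= 1, the class only constrains increments and contains all
    constants, so that the risk is large for a cruder reason: c and
    c + 1 are indistinguishable from n observations when c is of order sqrt n,
    wherever the design points are.

    The measure-theoretic part makes the change of law rigorous on an abstract
    probability space: the law of the noise vector is determined by its values on
    boxes ([tuple_measure_unique]), and there it factors by independence
    ([integral_prod_indep], [change_of_measure]). *)

(** * Images of weighted measures *)

(** Bundling the set function as a measure lets uniqueness theorems for measures
    apply to weighted laws. *)
Lemma weighted_law_measure d d' (T : measurableType d) (S : measurableType d')
    (R : realType) (mu : {measure set T -> \bar R}) (X : T -> S) (w : T -> R) :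
  measurable_fun setT X -> measurable_fun setT w -> (forall y, 0 <= w y) ->
  exists nu : {measure set S -> \bar R}, forall B, measurable B ->
    nu B = (\int[mu]_(y in X @^-1` B) (w y)%:E)%E.
Proof.
move=> mX mw w0.
pose nu (B : set S) := (\int[mu]_(y in X @^-1` B) (w y)%:E)%E.
have nu0 : nu set0 = 0%E by rewrite /nu preimage_set0 integral_set0.
have nuge0 B : (0 <= nu B)%E by apply: integral_ge0 => y _; rewrite lee_fin.
have nusa : semi_sigma_additive nu.
  move=> F mF tF mUF; rewrite /nu preimage_bigcup ge0_integral_bigcup//.
  - apply: is_cvg_ereal_nneg_natsum => n _.
    by apply: integral_ge0 => y _; rewrite lee_fin.
  - by move=> k; rewrite -[_ @^-1` _]setTI; exact: mX.
  - by apply: (measurable_funS measurableT) => //; exact/measurable_EFinP.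
  - by move=> y _; rewrite lee_fin.
  - apply/trivIsetP => i j _ _ ij; rewrite -preimage_setI.
    by move/trivIsetP : tF => -> //; rewrite preimage_set0.
pose nuM := isMeasure.Build _ _ _ nu nu0 nuge0 nusa.
pose nu' : {measure set S -> \bar R} := HB.pack nu nuM.
by exists nu'.
Qed.

(** Knowing a weighted law on sets is enough to integrate against it: both sides
    agree on indicators by hypothesis, hence on simple functions, and pass to
    the limit by monotone convergence.  The case [X = id] is integration against
    a density, the case [w = 1] is the image-measure formula. *)
Lemma integral_weighted_law d d' (T : measurableType d) (S : measurableType d')
    (R : realType) (mu : {measure set T -> \bar R})
    (nu : {measure set S -> \bar R}) (X : T -> S) (w : T -> R)
    (f : S -> R) :
  measurable_fun setT X -> measurable_fun setT w -> (forall y, 0 <= w y) ->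
  measurable_fun setT f -> (forall z, 0 <= f z) ->
  (forall B, measurable B -> nu B = (\int[mu]_(y in X @^-1` B) (w y)%:E)%E) ->
  (\int[nu]_z (f z)%:E = \int[mu]_y (w y * f (X y))%:E)%E.
Proof.
move=> mX mw w0 mf f0 nuE.
have mEf : measurable_fun setT (EFin \o f) by exact/measurable_EFinP.
pose f_ := nnsfun_approx measurableT mEf.
have mXB B : measurable B -> measurable (X @^-1` B).
  by move=> mB; rewrite -[_ @^-1` _]setTI; exact: mX.
have cvf z : (f_ n z)%:E @[n --> \oo] --> (f z)%:E.
  by apply: cvg_nnsfun_approx => //= x _; rewrite lee_fin.
have ndf z : {homo (fun n => f_ n z) : m n / (m <= n)%N >-> m <= n}.
  by move=> m n mn; exact/lefP/nd_nnsfun_approx.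
have step n : (\int[nu]_z (f_ n z)%:E = \int[mu]_y (w y * f_ n (X y))%:E)%E.
  under eq_integral do rewrite fimfunE -fsumEFin//.
  rewrite ge0_integral_fsum//; last 2 first.
  - by move=> y; exact/measurable_EFinP/measurable_funM.
  - by move=> y x _; rewrite nnfun_muleindic_ge0.
  transitivity (\sum_(k \in range (f_ n))
     \int[mu]_y (w y * (k * \1_(f_ n @^-1` [set k]) (X y)))%:E)%E.
    apply: eq_fsbigr => r /[!inE] -[z0 _ rE].
    have r0 : 0 <= r by rewrite -rE.
    under eq_integral do rewrite EFinM.
    rewrite ge0_integralZl//; [|exact/measurable_EFinP].
    rewrite integral_indic//= setIT nuE// integral_mkcond.
    rewrite -ge0_integralZl//; last 2 first.
    - apply/(measurable_restrictT _ _).1 => //; first exact: mXB.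
      by apply: (measurable_funS measurableT) => //; exact/measurable_EFinP.
    - by move=> y _; apply: erestrict_ge0 => t _; rewrite lee_fin.
    - apply: eq_integral => y _; rewrite /patch indicE.
      rewrite /= [y \in _](_ : _ = (X y \in f_ n @^-1` [set r])); last first.
        by apply/idP/idP; rewrite !inE.
      by case: ifP; rewrite /= ?mulr1 ?mulr0 ?mule0// mulrC EFinM.
  rewrite -ge0_integral_fsum//.
  - apply: eq_integral => y _; rewrite fsumEFin//; congr EFin.
    by rewrite [in RHS]fimfunE mulr_fsumr.
  - move=> r; apply/measurable_EFinP/measurable_funM => //.
    by apply: measurable_funM => //; apply: measurableT_comp.
  - move=> r y _; rewrite EFinM mule_ge0// ?lee_fin//.
    exact: nnfun_muleindic_ge0.
transitivity (limn (fun n => \int[nu]_z (f_ n z)%:E)%E).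
  rewrite -monotone_convergence//.
  - by apply: eq_integral => z _; apply/esym/cvg_lim.
  - by move=> n; exact/measurable_EFinP.
  - by move=> n y _; rewrite lee_fin.
  - by move=> z _ m n mn; rewrite lee_fin; exact: ndf.
rewrite (congr_lim (g := fun n => \int[mu]_y (w y * f_ n (X y))%:E)%E); last first.
  by apply/funext => n; exact: step.
rewrite -monotone_convergence//.
- apply: eq_integral => y _; apply/cvg_lim => //.
  under eq_fun do rewrite EFinM.
  rewrite EFinM; apply: cvgeZl => //.
- move=> n; apply/measurable_EFinP/measurable_funM => //.
  exact: measurableT_comp.
- by move=> n y _; rewrite lee_fin mulr_ge0.
- by move=> y _ m n mn; rewrite lee_fin ler_wpM2l//; exact: ndf.
Qed.

(** * Expectations of products of independent variables *)

Lemma indicator_prod (T : Type) (R : realType) (n : nat) (A : 'I_n -> set T)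
    (y : T) :
  \prod_(i < n) \1_(A i) y = \1_(\bigcap_(i in [set` [set: 'I_n]%SET]) A i) y :> R.
Proof.
rewrite indicE; case: (boolP (y \in _)) => [|yA].
  rewrite inE => yA; rewrite big1// => i _; rewrite indicE mem_set//.
  by apply: yA; rewrite /= inE.
suff [i iA] : exists i, y \notin A i.
  by rewrite (bigD1 i)//= indicE (negbTE iA) mul0r.
apply: contrapT => nex; move/negP : yA; apply; apply/mem_set => i _.
by apply: contrapT => nA; apply: nex; exists i; apply/negP; rewrite inE.
Qed.

(** Independence is the case of indicators.  The indicators are then replaced by
    the general factors one coordinate at a time: when the other factors are
    frozen as a weight, the weighted law of one coordinate is, by the previous
    stage, a multiple of its law. *)
Lemma integral_prod_indep d (T : measurableType d) (R : realType)
    (P : probability T R) (n : nat) (X : 'I_n -> {RV P >-> R})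
    (f : 'I_n -> R -> R) (e : 'I_n -> R) :
  mutually_independent X ->
  (forall i, measurable_fun setT (f i)) -> (forall i z, 0 <= f i z) ->
  (forall i, \int[P]_y (f i (X i y))%:E = (e i)%:E)%E ->
  (\int[P]_y (\prod_(i < n) f i (X i y))%:E = (\prod_(i < n) e i)%:E)%E.
Proof.
move=> indX.
(* From coordinate k on, the factors are indicators. *)
suff claim k : (k <= n)%N -> forall (f : 'I_n -> R -> R) (e : 'I_n -> R),
    (forall i, measurable_fun setT (f i)) -> (forall i z, 0 <= f i z) ->
    (forall i : 'I_n, (k <= i)%N -> exists2 B, measurable B & f i = \1_B) ->
    (forall i, \int[P]_y (f i (X i y))%:E = (e i)%:E)%E ->
    (\int[P]_y (\prod_(i < n) f i (X i y))%:E = (\prod_(i < n) e i)%:E)%E.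
  move=> mf f0 ef; apply: (claim n) => // i.
  by rewrite leqNgt ltn_ord.
elim: k => [_|k IH kn] {}f {}e mf f0 fB ef.
  have /choice[B BE] : forall i, exists B, measurable B /\ f i = \1_B.
    by move=> i; have [B mB fiE] := fB i isT; exists B.
  have mB i := (BE i).1; have fE i := (BE i).2.
  have mXB i : measurable (X i @^-1` B i).
    by rewrite -[_ @^-1` _]setTI; exact/measurable_funP.
  have eE i : (e i)%:E = P (X i @^-1` B i).
    rewrite -ef fE (_ : (fun y => _) = EFin \o \1_(X i @^-1` B i)).
      by rewrite integral_indic// setIT.
    by apply/funext => y /=; rewrite !indicE.
  transitivity (\int[P]_y
      (\1_(\bigcap_(i in [set` [set: 'I_n]%SET]) (X i @^-1` B i)) y)%:E)%E.
    by apply: eq_integral => y _; rewrite -indicator_prod; congr EFin;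
      apply: eq_bigr => i _; rewrite fE !indicE.
  rewrite integral_indic//; last first.
    by apply: fin_bigcap_measurable => //; exact: finite_finset.
  rewrite setIT; apply: (etrans (indX [set: 'I_n]%SET B mB)).
  by rewrite -prodEFin; apply: eq_big => [i|i _]; rewrite ?inE.
pose k0 := Ordinal kn.
pose w y := \prod_(i < n | i != k0) f i (X i y).
pose c := \prod_(i < n | i != k0) e i.
have e0 i : 0 <= e i.
  by rewrite -lee_fin -ef; apply: integral_ge0 => y _; rewrite lee_fin.
have c0 : 0 <= c by apply: prodr_ge0.
have w0 y : 0 <= w y by apply: prodr_ge0.
have mw : measurable_fun setT w.
  rewrite /w; under eq_fun do rewrite -big_filter.
  by apply: measurable_prod => i _; exact: measurableT_comp.
have wB B : measurable B ->
    mscale (NngNum c0) (pushforward P (X k0)) B =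
    (\int[P]_(y in X k0 @^-1` B) (w y)%:E)%E.
  move=> mB; rewrite /mscale/= /pushforward.
  pose f' i := if i == k0 then \1_B else f i.
  pose e' i := if i == k0 then fine (P (X k0 @^-1` B)) else e i.
  have mXB : measurable (X k0 @^-1` B).
    by rewrite -[_ @^-1` _]setTI; exact/measurable_funP.
  have := IH (ltnW kn) f' e'.
  rewrite (bigD1 k0)//= [X in (X * _)%:E]/e' eqxx.
  rewrite (eq_bigr e) => [IH'|i /negbTE ik]; last by rewrite /e' ik.
  rewrite muleC -[in LHS](@fineK _ (P _)) ?fin_num_measure//.
  rewrite -EFinM -IH'.
  - rewrite [RHS]integral_mkcond; apply: eq_integral => y _.
    rewrite (bigD1 k0)//= {1}/f' eqxx (eq_bigr (fun i => f i (X i y))); last first.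
      by move=> i /negbTE ik; rewrite /f' ik.
    rewrite /patch indicE (_ : (y \in X k0 @^-1` B) = (X k0 y \in B)); last first.
      by apply/idP/idP; rewrite !inE.
    by case: ifP; rewrite ?mul1r ?mul0r.
  - by move=> i; rewrite /f'; case: ifP.
  - by move=> i z; rewrite /f'; case: ifP => // _; rewrite indicE.
  - move=> i ki; rewrite /f'; case: ifPn => [_|ik]; first by exists B.
    by apply: fB; rewrite ltn_neqAle ki andbT eq_sym.
  - move=> i; rewrite /f' /e'; case: ifP => [/eqP ->|_]; last exact: ef.
    rewrite fineK ?fin_num_measure//.
    rewrite (_ : (fun y => _) = EFin \o \1_(X k0 @^-1` B)).
      by rewrite integral_indic// setIT.
    by apply/funext => y /=; rewrite !indicE.
transitivity (\int[P]_y (w y * f k0 (X k0 y))%:E)%E.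
  by apply: eq_integral => y _; rewrite (bigD1 k0)//= mulrC.
have mX : measurable_fun setT (X k0) by [].
rewrite -(integral_weighted_law mX mw w0 (mf k0) (f0 k0) (wB mX)).
rewrite ge0_integral_mscale//; last 2 first.
- exact/measurable_EFinP.
- by move=> z _; rewrite lee_fin.
rewrite ge0_integral_pushforward//; last 2 first.
- exact/measurable_EFinP.
- by move=> z _; rewrite lee_fin.
by rewrite preimage_setT ef (bigD1 k0)//= EFinM muleC.
Qed.

(** * Change of law for a vector of independent variables *)

Lemma measurable_box d (S : measurableType d) (n : nat) (B : 'I_n -> set S) :
  (forall i, measurable (B i)) ->
  measurable [set t : n.-tuple S | forall i, B i (tnth t i)].
Proof.
move=> mB.
rewrite (_ : mkset _ =
    \bigcap_(i in [set` [set: 'I_n]%SET]) ((fun t => tnth t i) @^-1` B i)).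
  apply: fin_bigcap_measurable => [|i _]; first exact: finite_finset.
  by rewrite -[_ @^-1` _]setTI; exact: measurable_tnth.
apply/seteqP; split => t /= Bt i; first by move=> _; exact: Bt.
by apply: Bt; rewrite /= inE.
Qed.

(** Boxes are stable under intersection and generate the product sigma-algebra. *)
Lemma tuple_measure_unique d (S : measurableType d) (R : realType) (n : nat)
    (m1 m2 : {measure set (n.-tuple S) -> \bar R}) :
  (m1 setT < +oo)%E ->
  (forall B : 'I_n -> set S, (forall i, measurable (B i)) ->
     m1 [set t | forall i, B i (tnth t i)] =
     m2 [set t | forall i, B i (tnth t i)]) ->
  forall A, measurable A -> m1 A = m2 A.
Proof.
move=> m1oo m12 A mA.
pose G := [set A : set (n.-tuple S) | exists2 B : 'I_n -> set S,
  (forall i, measurable (B i)) & A = [set t | forall i, B i (tnth t i)]].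
have Gm : G `<=` measurable.
  by move=> _ [B mB ->]; exact: measurable_box.
have GT : G setT.
  by exists (fun=> setT) => //; apply/seteqP; split.
apply: (g_sigma_algebra_measure_unique G Gm (fun=> setT)) => //.
- by rewrite bigcup_const//; exists 0%N.
- move=> _ _ [B mB ->] [C mC ->]; exists (fun i => B i `&` C i).
    by move=> i; exact: measurableI.
  apply/seteqP; split => t /=; first by move=> [Bt Ct] i; split.
  by move=> BCt; split => i; case: (BCt i).
- by move=> _ [B mB ->]; exact: m12.
- move: A mA; apply: smallest_sub; first exact: smallest_sigma_algebra.
  move=> U; rewrite -bigcup_seq => -[i _ [C mC <-]].
  apply: sub_sigma_algebra; rewrite setTI.
  (* A cylinder over one coordinate is a box whose other sides are full. *)
  exists (fun j => if j == i then C else setT).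
    by move=> j; case: ifP.
  apply/seteqP; split => t /= Ct.
    by move=> j; case: eqP => // ->.
  by have := Ct i; rewrite eqxx.
Qed.

Lemma measurable_mktuple d d' (T : measurableType d) (S : measurableType d')
    (n : nat) (X : 'I_n -> T -> S) :
  (forall i, measurable_fun setT (X i)) ->
  measurable_fun setT (fun y => [tuple X i y | i < n]).
Proof.
move=> mX; apply/measurable_fun_tnthP => i.
by rewrite (_ : _ \o _ = X i)//; apply/funext => y /=; rewrite tnth_mktuple.
Qed.

(** A reweighting of each coordinate by [l i] that has the effect of
    transforming it by [h i] does so jointly under independence: the
    two laws on tuples agree on boxes. *)
Lemma change_of_measure d (T : measurableType d) (R : realType)
    (P : probability T R) (n : nat) (X : 'I_n -> {RV P >-> R})
    (h l : 'I_n -> R -> R) (F : n.-tuple R -> R) :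
  mutually_independent X ->
  (forall i, measurable_fun setT (h i)) ->
  (forall i, measurable_fun setT (l i)) -> (forall i z, 0 <= l i z) ->
  (forall i B, measurable B ->
     (\int[P]_(y in X i @^-1` B) (l i (X i y))%:E = P (X i @^-1` (h i @^-1` B)))%E) ->
  measurable_fun setT F -> (forall t, 0 <= F t) ->
  (\int[P]_y (\prod_(i < n) l i (X i y) * F [tuple X i y | i < n])%:E =
   \int[P]_y (F [tuple h i (X i y) | i < n])%:E)%E.
Proof.
move=> indX mh ml l0 lE mF F0.
have mX : measurable_fun setT (fun y => [tuple X i y | i < n]).
  exact: measurable_mktuple.
have mhX : measurable_fun setT (fun y => [tuple h i (X i y) | i < n]).
  by apply: measurable_mktuple => i; exact: measurableT_comp.
have mL : measurable_fun setT (fun y => \prod_(i < n) l i (X i y)).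
  by apply: measurable_prod => i _; exact: measurableT_comp.
have L0 y : 0 <= \prod_(i < n) l i (X i y) by apply: prodr_ge0.
have [nu nuE] := weighted_law_measure P mX mL L0.
rewrite -(integral_weighted_law mX mL L0 mF F0 nuE).
transitivity (\int[pushforward P (fun y => [tuple h i (X i y) | i < n])]_t
   (F t)%:E)%E; last first.
  rewrite ge0_integral_pushforward//.
  - exact/measurable_EFinP.
  - by move=> t _; rewrite lee_fin.
have boxE B : (forall i, measurable (B i)) ->
    nu [set t | forall i, B i (tnth t i)] =
    pushforward P (fun y => [tuple h i (X i y) | i < n])
      [set t | forall i, B i (tnth t i)].
  move=> mB; rewrite nuE; last exact: measurable_box.
  have mhB i : measurable (h i @^-1` B i).
    by rewrite -[_ @^-1` _]setTI; exact: mh.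
  have mXB i C : measurable C -> measurable (X i @^-1` C).
    by move=> mC; rewrite -[_ @^-1` _]setTI; exact/measurable_funP.
  pose f i z := \1_(B i) z * l i z.
  pose e i := fine (P (X i @^-1` (h i @^-1` B i))).
  transitivity (\int[P]_y (\prod_(i < n) f i (X i y))%:E)%E.
    rewrite [LHS]integral_mkcond; apply: eq_integral => y _; rewrite /patch.
    rewrite big_split/= (_ : \prod_(i < n) \1_(B i) (X i y) =
      \1_[set t : n.-tuple R | forall i, B i (tnth t i)] [tuple X i y | i < n]).
      rewrite indicE (_ : (y \in _) = ([tuple X i y | i < n] \in
        [set t : n.-tuple R | forall i, B i (tnth t i)])); last first.
        by apply/idP/idP; rewrite !inE.
      by case: ifP => _; rewrite ?mul1r ?mul0r.
    rewrite (eq_bigr (fun i => \1_(X i @^-1` B i) y)); last first.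
      by move=> i _; rewrite !indicE.
    rewrite indicator_prod !indicE; congr ((nat_of_bool _)%:R); apply/idP/idP; rewrite !inE.
      by move=> Bt i; have := Bt i; rewrite tnth_mktuple; apply; rewrite /= inE.
    by move=> Bt i _; have := Bt i; rewrite tnth_mktuple.
  rewrite (@integral_prod_indep _ _ _ _ _ _ f e)//.
  - rewrite /pushforward.
    rewrite (_ : _ @^-1` _ =
      \bigcap_(i in [set` [set: 'I_n]%SET]) (X i @^-1` (h i @^-1` B i))); last first.
      apply/seteqP; split => y /= Bt i.
        by move=> _; have := Bt i; rewrite tnth_mktuple.
      by rewrite tnth_mktuple; apply: Bt; rewrite /= inE.
    apply: esym; apply: (etrans (indX [set: 'I_n]%SET (fun i => h i @^-1` B i) mhB)).
    rewrite -prodEFin; apply: eq_big => [i|i _]; first by rewrite inE.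
    by rewrite fineK// fin_num_measure//; exact: mXB.
  - by move=> i; apply: measurable_funM.
  - by move=> i z; rewrite mulr_ge0// indicE.
  - move=> i; rewrite fineK ?fin_num_measure//; last exact: mXB.
    rewrite -lE// [RHS]integral_mkcond; apply: eq_integral => y _; rewrite /patch.
    rewrite /f indicE (_ : (y \in _) = (X i y \in B i)); last first.
      by apply/idP/idP; rewrite !inE.
    by case: ifP => _; rewrite ?mul1r ?mul0r.
apply: eq_measure_integral => A mA _; apply: tuple_measure_unique => //.
have -> : [set: n.-tuple R] = [set t | forall i : 'I_n, setT (tnth t i)].
  by apply/seteqP; split.
rewrite (boxE (fun=> setT))// (@le_lt_trans _ _ 1%E) ?ltry//.
apply: probability_le1; rewrite -[_ @^-1` _]setTI; apply: mhX => //.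
exact: (measurable_box (B := fun=> setT)).
Qed.

(** * Likelihood ratios of centred Gaussian laws *)

(** Both sides come from measures that agree on half-open intervals, which
    determine the Lebesgue measure. *)
Lemma integral_lebesgue_scale (R : realType) (s : R) (f : R -> R) :
  0 < s -> measurable_fun setT f -> (forall z, 0 <= f z) ->
  (\int[lebesgue_measure]_z (f z)%:E =
   \int[lebesgue_measure]_z (s * f (s * z))%:E)%E.
Proof.
move=> s0 mf f0.
have mX : measurable_fun setT
    ((fun z => s * z) : measurableTypeR R -> measurableTypeR R).
  exact: measurable_funM.
have mw : measurable_fun setT (fun _ : measurableTypeR R => s) by [].
have w0 (y : measurableTypeR R) : 0 <= s by exact: ltW.
have [nu nuE] := weighted_law_measure lebesgue_measure mX mw w0.
apply: (@integral_weighted_law _ _ _ _ _ lebesgue_measure lebesgue_measure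
  _ (fun=> s) f mX mw w0 mf f0) => B mB.
rewrite -nuE//; apply: lebesgue_measure_unique => // _ [[a b]] _ <-.
rewrite nuE//= integral_cst//; last by rewrite -[_ @^-1` _]setTI; apply: mX.
have -> : (fun z => s * z) @^-1` [set` Interval (BRight a) (BRight b)] =
    [set` Interval (BRight (a / s)) (BRight (b / s))].
  apply/seteqP; split => z /=; rewrite !in_itv/=.
    by rewrite ltr_pdivrMr// ler_pdivlMr// ![s * z]mulrC.
  by rewrite ltr_pdivrMr// ler_pdivlMr// ![s * z]mulrC.
rewrite lebesgue_measure_itv/= (@lebesgue_measure_itv R
  (Interval (BRight (a / s)) (BRight (b / s))))/= !lte_fin ltr_pM2r ?invr_gt0//.
case: ifP => _; last by rewrite mule0.
by rewrite -!EFinB -EFinM -mulrBl mulrCA mulfV ?gt_eqF// mulr1.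
Qed.

Lemma normal_pdf_scale (R : realType) (s z : R) : 0 < s ->
  normal_pdf 0 s z = s^-1 * normal_peak 1 * expR (- (s^-1 ^+ 2 / 2) * z ^+ 2).
Proof.
move=> s0; rewrite normal_pdfE ?gt_eqF// /normal_fun subr0; congr (_ * expR _).
  rewrite /normal_peak -invfM; congr (_^-1).
  rewrite expr1n mul1r -mulrnAr sqrtrM ?sqr_ge0// sqrtr_sqr gtr0_norm//.
by field; rewrite gt_eqF.
Qed.

Lemma normal_prob_scale (R : realType) (s : R) (B : set R) : 0 < s ->
  measurable B ->
  normal_prob 0 s B = normal_prob 0 1 ((fun z => s * z) @^-1` B).
Proof.
move=> s0 mB; rewrite /normal_prob integral_mkcond [RHS]integral_mkcond.
pose f z := \1_B z * normal_pdf 0 s z.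
have mf : measurable_fun setT f.
  by apply: measurable_funM => //; exact: measurable_normal_pdf.
have f0 z : 0 <= f z by rewrite mulr_ge0 ?normal_pdf_ge0// indicE.
transitivity (\int[lebesgue_measure]_z (f z)%:E)%E.
  apply: eq_integral => z _; rewrite /patch /f indicE.
  by case: ifP => _; rewrite ?mul1r ?mul0r.
rewrite (integral_lebesgue_scale s0 mf f0).
apply: eq_integral => z _; rewrite /patch /f indicE.
rewrite (_ : (z \in _) = (s * z \in B)); last by apply/idP/idP; rewrite !inE.
case: ifP => _; rewrite ?mul1r ?mul0r ?mulr0//; congr EFin.
rewrite !normal_pdf_scale// invr1 mul1r !mulrA divff ?gt_eqF// mul1r.
by congr (_ * expR _); field; rewrite gt_eqF.
Qed.

(** The density of the centred normal law of standard deviation [s] with respect to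
    the standard one, see [normal_lrE]. *)
Definition normal_lr (R : realType) (s z : R) : R :=
  s^-1 * expR ((1 - s^-1 ^+ 2) / 2 * z ^+ 2).

Lemma normal_lrE (R : realType) (s z : R) : 0 < s ->
  normal_pdf 0 1 z * normal_lr s z = normal_pdf 0 s z.
Proof.
move=> s0; rewrite !normal_pdf_scale// /normal_lr invr1 mul1r.
rewrite [in LHS]mulrCA -!mulrA; congr (_ * (_ * _)).
rewrite -expRD; congr expR; field; rewrite gt_eqF//.
Qed.

Lemma normal_lr_ge0 (R : realType) (s z : R) : 0 < s -> 0 <= normal_lr s z.
Proof. by move=> s0; rewrite mulr_ge0 ?expR_ge0 ?invr_ge0// ltW. Qed.

Lemma measurable_normal_lr (R : realType) (s : R) :
  measurable_fun setT (normal_lr s).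
Proof.
apply: measurable_funM => //; apply: measurableT_comp => //.
by apply: measurable_funM => //; exact: measurable_funX.
Qed.

Lemma integral_standard_normal d (T : measurableType d) (R : realType)
    (P : probability T R) (X : {RV P >-> R}) (f : R -> R) :
  (forall A, measurable A -> distribution P X A = normal_prob 0 1 A) ->
  measurable_fun setT f -> (forall z, 0 <= f z) ->
  (\int[P]_y (f (X y))%:E =
   \int[lebesgue_measure]_z (normal_pdf 0 1 z * f z)%:E)%E.
Proof.
move=> XN mf f0.
have mEf : measurable_fun setT (EFin \o f) by exact/measurable_EFinP.
have Ef0 z : (0 <= (EFin \o f) z)%E by rewrite lee_fin.
rewrite -(ge0_integral_distribution X mEf Ef0).
apply: (@integral_weighted_law _ _ (measurableTypeR R) _ R lebesgue_measure
  (distribution P X) idfun (normal_pdf 0 1) f _ (measurable_normal_pdf 0 1)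
  (normal_pdf_ge0 0 1) mf f0) => [|B mB]; first exact: measurable_id.
by rewrite preimage_id; exact: XN.
Qed.

Lemma integral_normal_lr d (T : measurableType d) (R : realType)
    (P : probability T R) (X : {RV P >-> R}) (s : R) (B : set R) :
  (forall A, measurable A -> distribution P X A = normal_prob 0 1 A) ->
  0 < s -> measurable B ->
  (\int[P]_(y in X @^-1` B) (normal_lr s (X y))%:E =
   P (X @^-1` ((fun z => s * z)%R @^-1` B)))%E.
Proof.
move=> XN s0 mB.
have mS : measurable ((fun z : R => s * z) @^-1` B).
  by rewrite -[_ @^-1` _]setTI; apply: measurable_funM.
have := XN _ mS; rewrite /distribution/= /pushforward/= => ->.
rewrite -normal_prob_scale// /normal_prob [LHS]integral_mkcond.
transitivity (\int[P]_y (\1_B (X y) * normal_lr s (X y))%:E)%E.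
  apply: eq_integral => y _; rewrite /patch indicE.
  rewrite (_ : (y \in _) = (X y \in B)); last by apply/idP/idP; rewrite !inE.
  by case: ifP => _; rewrite ?mul1r ?mul0r.
rewrite (@integral_standard_normal _ _ _ _ _ (fun z => \1_B z * normal_lr s z))//.
- rewrite [RHS]integral_mkcond; apply: eq_integral => z _; rewrite /patch indicE.
  by case: ifP => _; rewrite ?mul1r ?mul0r ?mulr0// normal_lrE.
- by apply: measurable_funM => //; exact: measurable_normal_lr.
- by move=> z; rewrite mulr_ge0 ?normal_lr_ge0// indicE.
Qed.

Lemma integral_normal_lr1 d (T : measurableType d) (R : realType)
    (P : probability T R) (X : {RV P >-> R}) (s : R) :
  (forall A, measurable A -> distribution P X A = normal_prob 0 1 A) ->
  0 < s -> (\int[P]_y (normal_lr s (X y))%:E = 1)%E.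
Proof.
move=> XN s0; have := integral_normal_lr XN s0 measurableT.
by rewrite !preimage_setT probability_setT.
Qed.

(** The square of the likelihood ratio times the standard density is again a
    Gaussian density up to a constant, with variance s^2 / (2 - s^2); this is
    where s^2 < 2 is needed.  The value is written in terms of the relative
    perturbation s^2 - 1 of the variance. *)
Lemma integral_normal_lr_sqr d (T : measurableType d) (R : realType)
    (P : probability T R) (X : {RV P >-> R}) (s : R) :
  (forall A, measurable A -> distribution P X A = normal_prob 0 1 A) ->
  0 < s -> s ^+ 2 < 2 ->
  (\int[P]_y (normal_lr s (X y) ^+ 2)%:E =
   (Num.sqrt (1 - (s ^+ 2 - 1) ^+ 2))^-1%:E)%E.
Proof.
move=> XN s0 s2.
rewrite (@integral_standard_normal _ _ _ _ _ (fun z => normal_lr s z ^+ 2))//; first last.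
- by move=> z; rewrite sqr_ge0.
- by apply: measurable_funX; exact: measurable_normal_lr.
pose q := 2 - s ^+ 2; have q0 : 0 < q by rewrite subr_gt0.
pose t := s / Num.sqrt q.
have t0 : 0 < t by rewrite divr_gt0// sqrtr_gt0.
have sq0 : 0 < Num.sqrt q by rewrite sqrtr_gt0.
have sq2 : Num.sqrt q ^+ 2 = q by rewrite sqr_sqrtr// ltW.
have ti : t^-1 ^+ 2 = 2 * s^-1 ^+ 2 - 1.
  rewrite /t invf_div expr_div_n sq2 /q; field; rewrite gt_eqF//.
transitivity (\int[lebesgue_measure]_z
  ((s * Num.sqrt q)^-1%:E * (normal_pdf 0 t z)%:E))%E.
  apply: eq_integral => z _; rewrite -EFinM; congr EFin.
  have eE : expR (- (1 ^-1 ^+ 2 / 2) * z ^+ 2) *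
      expR ((1 - s^-1 ^+ 2) / 2 * z ^+ 2) ^+ 2 =
      expR (- (t^-1 ^+ 2 / 2) * z ^+ 2).
    rewrite -expRM_natl -expRD ti invr1; congr expR.
    by move: (s^-1 ^+ 2) => v; field.
  have cE : s^-1 ^+ 2 = (s * Num.sqrt q)^-1 * t^-1.
    by rewrite /t invf_div; field; rewrite !gt_eqF.
  rewrite !normal_pdf_scale// -eE /normal_lr exprMn cE invr1.
  by ring.
rewrite ge0_integralZl//; first last.
- by rewrite lee_fin invr_ge0 mulr_ge0 ?ltW.
- by move=> z _; rewrite lee_fin normal_pdf_ge0.
- by apply/measurable_EFinP; exact: measurable_normal_pdf.
rewrite integral_normal_pdf mule1 (_ : 1 - _ = s ^+ 2 * q); last by rewrite /q; ring.
by rewrite sqrtrM ?sqr_ge0// sqrtr_sqr gtr0_norm.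
Qed.

(** * The two-point lower bound *)

(** After multiplication by 1 + L the difference of the two sides is
    ((1 + L) a - L delta)^2 + delta^2 L ((1 + L) / 3 - 1)^2.  The added
    terms are affine in L and L^2, so that integration only involves E[L] = 1 and
    a bound on E[L^2]; the value L = 2 at which the last square vanishes is the
    optimal one when E[L^2] = 2. *)
Lemma two_point_pointwise (R : realType) (a delta L : R) : 0 <= L ->
  2 / 3 * delta ^+ 2 * L <=
  a ^+ 2 + L * (a - delta) ^+ 2 + delta ^+ 2 / 9 * (L + L ^+ 2).
Proof.
move=> L0; have L1 : 0 < 1 + L by lra.
rewrite -subr_ge0 -(pmulr_rge0 _ L1).
have -> : (1 + L) * (a ^+ 2 + L * (a - delta) ^+ 2 +
      delta ^+ 2 / 9 * (L + L ^+ 2) - 2 / 3 * delta ^+ 2 * L) =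
    ((1 + L) * a - L * delta) ^+ 2 + delta ^+ 2 * L * ((1 + L) / 3 - 1) ^+ 2.
  by field.
by rewrite addr_ge0 ?sqr_ge0// mulr_ge0 ?sqr_ge0// mulr_ge0// sqr_ge0.
Qed.

Lemma prodr_onem_ge (R : realType) (I : Type) (s : seq I) (u : I -> R) :
  (forall i, 0 <= u i <= 1) ->
  1 - \sum_(i <- s) u i <= \prod_(i <- s) (1 - u i).
Proof.
move=> u01; suff : 1 - \sum_(i <- s) u i <= \prod_(i <- s) (1 - u i) <= 1.
  by case/andP.
elim: s => [|i s /andP[IHl IHr]]; first by rewrite !big_nil subr0 lexx.
rewrite !big_cons; have := u01 i; move: IHl IHr (u i) => + + ui.
have : 0 <= \prod_(j <- s) (1 - u j).
  by apply: prodr_ge0 => j _; have := u01 j; lra.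
move: (\prod_(j <- s) _) (\sum_(j <- s) _) => p q p0 pl pr ui01.
by nra.
Qed.

(** On [0, 1] the square root dominates the identity, so the square roots can be
    dropped before the Weierstrass product inequality is applied. *)
Lemma prod_chi_square_le2 (R : realType) (n : nat) (u : 'I_n -> R) :
  (forall i, 0 <= u i) -> \sum_(i < n) u i <= 2^-1 ->
  \prod_(i < n) (Num.sqrt (1 - u i))^-1 <= 2.
Proof.
move=> u0 su.
have u1 i : u i <= 2^-1.
  by apply: le_trans su; rewrite (bigD1 i)//= lerDl sumr_ge0.
have u01 i : 0 <= u i <= 1 by rewrite u0/=; have := u1 i; lra.
have le2 : 2^-1 <= \prod_(i < n) Num.sqrt (1 - u i).
  have le1 : 2^-1 <= 1 - \sum_(i < n) u i by lra.
  apply: (le_trans le1); apply: (le_trans (prodr_onem_ge _ u01)).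
  apply: ler_prod => i _; have := u1 i; have := u0 i => ui0 ui1.
  have v0 : 0 <= 1 - u i by lra.
  rewrite v0/= -[leLHS]ger0_norm// -sqrtr_sqr ler_wsqrtr//.
  by move: ui0 v0 {le1}; nra.
rewrite prodfV -[leRHS]invrK lef_pV2// posrE ?invr_gt0//.
by apply: lt_le_trans le2; rewrite invr_gt0.
Qed.

(** The risk under V is rewritten as an integral against the likelihood ratio of
    the two observation laws.  Any estimator then pays for the separation of the
    two values at x0, at a price that is fixed by the bound 2 on the second moment
    of that ratio. *)
Lemma two_point_risk d (T : measurableType d) (R : realType)
    (P : probability T R) (n : nat) (x : 'I_n -> R)
    (eps : 'I_n -> {RV P >-> R}) (x0 c : R) (V : R -> R)
    (Vt : n.-tuple R -> R) :
  mutually_independent eps ->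
  (forall i A, measurable A ->
     distribution P (eps i) A = normal_prob 0 1 A) ->
  0 < c -> \sum_(i < n) (V (x i) / c - 1) ^+ 2 <= 2^-1 ->
  measurable_fun setT Vt ->
  (((V x0 - c) ^+ 2 / 3)%:E <=
   pointwise_risk x eps x0 (cst c) (cst 0%R) Vt +
   pointwise_risk x eps x0 V (cst 0%R) Vt)%E.
Proof.
move=> ind eN c0 sV mVt.
pose u i := (V (x i) / c - 1) ^+ 2.
have u0 i : 0 <= u i by rewrite sqr_ge0.
have u1 i : u i <= 2^-1.
  apply: le_trans sV; rewrite (bigD1 i)//= lerDl.
  by apply: sumr_ge0 => j _; exact: u0.
have v0 i : 0 < V (x i) / c.
  have := u1 i; rewrite /u; move: (V _ / c) => v; rewrite ltNge => uv.
  apply/negP => v_le0; have : 1 <= (1 - v) ^+ 2 by rewrite exprn_ege1//; lra.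
  by rewrite -sqrrN opprB => uv1; lra.
(* The noise of observation i under V is [s i] times its noise under [c]. *)
pose s i := Num.sqrt (V (x i) / c).
have s0 i : 0 < s i by rewrite sqrtr_gt0.
have s2 i : s i ^+ 2 = V (x i) / c by rewrite sqr_sqrtr// ltW.
have s22 i : s i ^+ 2 < 2.
  have := u1 i; rewrite s2 /u; move: (V _ / c) => v uv; rewrite ltNge.
  apply/negP => v_ge2; have : 1 <= (v - 1) ^+ 2 by rewrite exprn_ege1//; lra.
  by move=> uv1; lra.
pose G (t : n.-tuple R) : R := Vt [tuple Num.sqrt c * tnth t i | i < n].
have mG : measurable_fun setT G.
  apply: measurableT_comp => //; apply: measurable_mktuple => i.
  by apply: measurable_funM => //; exact: measurable_tnth.
pose L y := \prod_(i < n) normal_lr (s i) (eps i y).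
pose A y := G [tuple eps i y | i < n] - c.
have L0 y : 0 <= L y by apply: prodr_ge0 => i _; exact: normal_lr_ge0.
have mL : measurable_fun setT L.
  apply: measurable_prod => i _; apply: measurableT_comp => //.
  exact: measurable_normal_lr.
have mA : measurable_fun setT A.
  apply: measurable_funB => //; apply: measurableT_comp => //.
  exact: measurable_mktuple.
have r0E : pointwise_risk x eps x0 (cst c) (cst 0%R) Vt =
    (\int[P]_y (A y ^+ 2)%:E)%E.
  rewrite /pointwise_risk unlock; apply: eq_integral => y _.
  congr ((_ - _) ^+ 2)%:E; rewrite /G; congr Vt.
  by apply: eq_from_tnth => i; rewrite !tnth_mktuple add0r.
have r1E : pointwise_risk x eps x0 V (cst 0%R) Vt =
    (\int[P]_y (L y * (A y - (V x0 - c)) ^+ 2)%:E)%E.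
  pose F t := (G t - V x0) ^+ 2.
  transitivity (\int[P]_y (F [tuple s i * eps i y | i < n])%:E)%E.
    rewrite /pointwise_risk unlock; apply: eq_integral => y _.
    congr ((_ - _) ^+ 2)%:E; rewrite /G; congr Vt.
    apply: eq_from_tnth => i; rewrite !tnth_mktuple add0r mulrA; congr (_ * _).
    by rewrite -sqrtrM ?ltW// mulrC divfK ?gt_eqF.
  rewrite -(@change_of_measure _ _ _ _ _ _ (fun i z => s i * z)
    (fun i => normal_lr (s i)) F)//.
  - by apply: eq_integral => y _; congr (_ * _ ^+ 2)%:E; rewrite /A; ring.
  - by move=> i; exact: measurable_funM.
  - by move=> i; exact: measurable_normal_lr.
  - by move=> i z; exact: normal_lr_ge0.
  - by move=> i B mB; rewrite integral_normal_lr//; exact: eN.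
  - by apply: measurable_funX; apply: measurable_funB.
  - by move=> t; rewrite sqr_ge0.
have EL : (\int[P]_y (L y)%:E = 1)%E.
  rewrite (@integral_prod_indep _ _ _ _ _ _ (fun i => normal_lr (s i)) (fun=> 1))//.
  - by rewrite big1.
  - by move=> i; exact: measurable_normal_lr.
  - by move=> i z; exact: normal_lr_ge0.
  - by move=> i; apply: integral_normal_lr1 => //; exact: eN.
have EL2 : (\int[P]_y (L y ^+ 2)%:E <= 2%:E)%E.
  under eq_integral do rewrite -prodrXl.
  rewrite (@integral_prod_indep _ _ _ _ _ _ (fun i z => normal_lr (s i) z ^+ 2)
    (fun i => (Num.sqrt (1 - u i))^-1))//.
  - by rewrite lee_fin prod_chi_square_le2.
  - by move=> i; apply: measurable_funX; exact: measurable_normal_lr.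
  - by move=> i z; exact: sqr_ge0.
  - move=> i; rewrite (@integral_normal_lr_sqr _ _ _ _ _ (s i))//; last exact: eN.
    by rewrite s2.
set delta := V x0 - c in r1E *.
rewrite r0E r1E.
have mE f : measurable_fun [set: T] f -> measurable_fun [set: T] (fun y => (f y : R)%:E).
  by move=> mf; apply/measurable_EFinP.
have m1 : measurable_fun setT (fun y => A y ^+ 2) by exact: measurable_funX.
have m2 : measurable_fun setT (fun y => L y * (A y - delta) ^+ 2).
  by apply: measurable_funM => //; apply: measurable_funX; exact: measurable_funB.
have m3 : measurable_fun setT (fun y => L y + L y ^+ 2).
  by apply: measurable_funD => //; exact: measurable_funX.
have d9 : 0 <= delta ^+ 2 / 9 by rewrite mulr_ge0 ?sqr_ge0.
have d23 : 0 <= 2 / 3 * delta ^+ 2 by rewrite mulr_ge0 ?sqr_ge0.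
have key : ((2 / 3 * delta ^+ 2)%:E <=
    \int[P]_y (A y ^+ 2)%:E + \int[P]_y (L y * (A y - delta) ^+ 2)%:E +
    (delta ^+ 2 / 9 * 3)%:E)%E.
  have -> : ((2 / 3 * delta ^+ 2)%:E = \int[P]_y (2 / 3 * delta ^+ 2 * L y)%:E)%E.
    under eq_integral do rewrite EFinM.
    rewrite ge0_integralZl//; first by rewrite EL mule1.
    - exact: mE.
    - by move=> y _; rewrite lee_fin.
  apply: (@le_trans _ _ (\int[P]_y ((A y ^+ 2)%:E + (L y * (A y - delta) ^+ 2)%:E +
      (delta ^+ 2 / 9 * (L y + L y ^+ 2))%:E))%E).
    apply: ge0_le_integral => //.
    - by move=> y _; rewrite lee_fin mulr_ge0.
    - by apply: mE; apply: measurable_funM.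
    - apply: emeasurable_funD; first by apply: emeasurable_funD; exact: mE.
      by apply: mE; apply: measurable_funM.
    - by move=> y _; rewrite -!EFinD lee_fin; exact: two_point_pointwise.
  rewrite ge0_integralD//; first last.
  - by apply: mE; apply: measurable_funM.
  - by move=> y _; rewrite lee_fin mulr_ge0// addr_ge0// sqr_ge0.
  - by apply: emeasurable_funD; exact: mE.
  - by move=> y _; apply: adde_ge0; rewrite lee_fin ?sqr_ge0// mulr_ge0 ?sqr_ge0.
  rewrite ge0_integralD//; first last.
  - exact: mE.
  - by move=> y _; rewrite lee_fin mulr_ge0 ?sqr_ge0.
  - exact: mE.
  - by move=> y _; rewrite lee_fin sqr_ge0.
  apply: leeD => //; under eq_integral do rewrite EFinM.
  rewrite ge0_integralZl//; first last.
  - by move=> y _; rewrite lee_fin addr_ge0// sqr_ge0.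
  - exact: mE.
  rewrite (EFinM (delta ^+ 2 / 9)); apply: lee_wpmul2l; first by rewrite lee_fin.
  under eq_integral do rewrite EFinD.
  rewrite ge0_integralD//; first last.
  - by apply: mE; exact: measurable_funX.
  - by move=> y _; rewrite lee_fin sqr_ge0.
  - exact: mE.
  - by move=> y _; rewrite lee_fin.
  rewrite EL (_ : 3%:E = 1%E + 2%:E)%E; last by rewrite -EFinD; congr EFin; ring.
  exact: leeD.
rewrite (_ : (delta ^+ 2 / 3) = 2 / 3 * delta ^+ 2 - delta ^+ 2 / 9 * 3); last by field.
by rewrite EFinB leeBlDr.
Qed.

(** * A compactly supported bump with explicit derivatives *)

Lemma is_derive_quadratic (R : realType) (f : R -> R) (x a C : R) :
  (forall h, `|f (x + h) - f x - a * h| <= C * h ^+ 2) -> is_derive x 1 f a.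
Proof.
move=> fC.
have cvf : h^-1 *: ((f \o shift x) (h *: (1 : R)) - f x) @[h --> 0^'] --> a.
  apply/cvgrPdist_le => e e0.
  have C0 : 0 <= C by have := le_trans (normr_ge0 _) (fC 1); rewrite expr1n mulr1.
  near=> h; have h0 : h != 0 by near: h; exact: nbhs_dnbhs_neq.
  rewrite /= /shift/= [h *: 1]mulr1 [h + x]addrC.
  have -> : a - h^-1 *: (f (x + h) - f x) = - h^-1 * (f (x + h) - f x - a * h).
    by rewrite /GRing.scale/=; field.
  rewrite normrM normrN normfV ler_pdivrMl ?normr_gt0//.
  apply: (le_trans (fC h)); rewrite -real_normK ?num_real// expr2 mulrA.
  rewrite [leRHS]mulrC ler_wpM2r//.
  apply: (@le_trans _ _ ((C + 1) * `|h|)); first by rewrite ler_wpM2r// lerDl.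
  rewrite -ler_pdivlMl; last by rewrite ltr_wpDl.
  near: h; apply: dnbhs0_le; rewrite mulr_gt0// invr_gt0 ltr_wpDl//.
apply: DeriveDef; first by apply/cvg_ex; exists a.
exact: cvg_lim.
Unshelve. all: by end_near. Qed.

(** The square of the positive part is treated by the second-order estimate, which
    covers the kink at 0; the higher powers follow since
    max(0, v)^(k+3) = v max(0, v)^(k+2), where both factors are differentiable. *)
Lemma is_derive_posX (R : realType) (k : nat) (x : R) :
  is_derive x 1 (fun v => Num.max 0 v ^+ k.+2) (k.+2%:R * Num.max 0 x ^+ k.+1).
Proof.
elim: k => [|k IH].
  apply: (@is_derive_quadratic _ _ _ _ 1) => h; rewrite mul1r expr1.
  rewrite ler_norml; have [x0|x0] := leP 0 x; have [y0|y0] := leP 0 (x + h);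
    by apply/andP; split; nra.
have maxE (v : R) : Num.max 0 v ^+ k.+3 = v * Num.max 0 v ^+ k.+2.
  by rewrite exprS; have [|] := leP 0 v => // _; rewrite !expr0n/= !mulr0.
have -> : (fun v : R => Num.max 0 v ^+ k.+3) = id * (fun v => Num.max 0 v ^+ k.+2).
  by apply/funext => v; rewrite maxE.
apply: is_derive_eq; rewrite /GRing.scale/= mulr1.
have xE : x * Num.max 0 x ^+ k.+1 = Num.max 0 x ^+ k.+2.
  by rewrite [RHS]exprS; have [|] := leP 0 x => // _; rewrite !expr0n/= !mulr0.
by rewrite mulrCA xE; ring.
Qed.

(** The polynomial factors of the successive derivatives of max(0, 1 - t^2)^N.
    Differentiating P(t) max(0, 1 - t^2)^(N - i) lowers the exponent by one and
    gives the recursion below, because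
    max(0, v)^(k+2) = v max(0, v)^(k+1). *)
Fixpoint bump_poly (R : realType) (N j : nat) : {poly R} :=
  if j is i.+1 then
    (bump_poly R N i)^`() * (1 - 'X^2) - ((N - i)%:R * 2) *: ('X * bump_poly R N i)
  else 1.

Definition bump_der (R : realType) (N j : nat) (t : R) : R :=
  (bump_poly R N j).[t] * Num.max 0 (1 - t ^+ 2) ^+ (N - j).

Lemma is_derive_bump (R : realType) (N j : nat) (t : R) : (j.+1 < N)%N ->
  is_derive t 1 (bump_der N j) (bump_der N j.+1 t).
Proof.
move=> jN; have [k kE] : exists k, (N - j = k.+2)%N.
  by exists (N - j - 2)%N; rewrite -[RHS](addn2 (N - j - 2)%N) subnK// ltn_subRL addn1.
have kE1 : (N - j.+1 = k.+1)%N by rewrite subnS kE.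
pose q (t : R) := 1 - t ^+ 2.
have dq : is_derive t 1 q (- (2 * t)).
  rewrite (_ : q = cst 1 - id ^+ 2)//.
  by apply: is_derive_eq; rewrite /GRing.scale/= expr1 mulr1 sub0r.
have := is_deriveM (is_derive_poly (bump_poly R N j) t)
  (is_derive1_comp (is_derive_posX k (q t)) dq).
rewrite (_ : horner _ * _ = bump_der N j); last first.
  by apply/funext => v; rewrite /bump_der kE.
move/is_derive_eq; apply.
rewrite /bump_der kE1 /= kE /GRing.scale/=.
rewrite !(hornerE, hornerZ) /GRing.scale/=.
have -> : Num.max 0 (q t) ^+ k.+2 = q t * Num.max 0 (q t) ^+ k.+1.
  by rewrite [LHS]exprS; have [|] := leP 0 (q t) => // _; rewrite !expr0n/= !mulr0.
by rewrite /q -/(q t); ring.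
Qed.

(** The derivatives vanish outside [-1, 1], where a polynomial is bounded by the sum
    of the absolute values of its coefficients. *)
Lemma bump_der_bounded (R : realType) (N m : nat) : (m < N)%N ->
  exists2 B : R, 0 < B & forall j t, (j <= m)%N -> `|bump_der N j t| <= B.
Proof.
move=> mN.
pose b j := \sum_(i < size (bump_poly R N j)) `|(bump_poly R N j)`_i|.
have b0 j : 0 <= b j by apply: sumr_ge0.
exists (1 + \sum_(j < m.+1) b j).
  by rewrite ltr_wpDr// sumr_ge0.
move=> j t jm; apply: (@le_trans _ _ (b j)); last first.
  rewrite (bigD1 (Ordinal (jm : (j < m.+1)%N)))//= addrCA lerDl addr_ge0//.
  exact: sumr_ge0.
rewrite /bump_der; have [t1|t1] := leP `|t| 1; last first.
  have -> : Num.max 0 (1 - t ^+ 2) = 0.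
    by rewrite max_l// subr_le0 -real_normK ?num_real// exprn_ege1// ltW.
  by rewrite expr0n subn_eq0 leqNgt (leq_ltn_trans jm mN)/= mulr0 normr0.
have t2 : t ^+ 2 <= 1 by rewrite -real_normK ?num_real// expr_le1.
rewrite normrM -[leRHS]mulr1 ler_pM//.
  rewrite horner_coef (le_trans (ler_norm_sum _ _ _))//.
  apply: ler_sum => i _; rewrite normrM ler_piMr// normrX exprn_ile1//.
rewrite normrX exprn_ile1// ger0_norm ?le_max ?lexx//.
by rewrite ge_max ler01/= lerBlDr lerDl sqr_ge0.
Qed.

(** * Membership in the smoothness classes *)

(** Exhibiting the chain of derivatives reduces membership to estimates, without
    any computation with iterated derivatives. *)
Lemma smooth_class_of_derivatives (R : realType) (C1 C2 gamma : R)
    (F : nat -> R -> R) :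
  (forall j (t : R), (j < strict_floor gamma)%N -> is_derive t 1 (F j) (F j.+1 t)) ->
  (forall s t, `|F (strict_floor gamma) s - F (strict_floor gamma) t| <=
     C1 * `|s - t| `^ (gamma - (strict_floor gamma)%:R)) ->
  (forall j t, (j < strict_floor gamma)%N -> `|F j t| <= C2) ->
  smooth_class C1 C2 gamma (F 0%N).
Proof.
set m := strict_floor gamma => dF hF bF.
have FE j : (j <= m)%N -> derive1n j (F 0%N) = F j.
  elim: j => [//|j IH jm]; rewrite derive1nS IH; last exact: ltnW.
  apply/funext => t; rewrite derive1E.
  by have := dF j t jm => dFj; rewrite derive_val.
split => [k t km _|s t _ _|k t km _]; rewrite FE//; try exact: ltnW.
- by have := dF k t km => dFk; exact: ex_derive.
- exact: bF.
Qed.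

(** When [strict_floor gamma] is 0 the class imposes no bound on the values, hence
    the guard on the bound of [c]. *)
Lemma smooth_class_cst (R : realType) (C1 C2 gamma c : R) :
  0 <= C1 -> 0 <= C2 -> ((0 < strict_floor gamma)%N -> `|c| <= C2) ->
  smooth_class C1 C2 gamma (cst c).
Proof.
move=> C10 C20 cC2.
pose F j : R -> R := cst (if j == 0%N then c else 0).
apply: (@smooth_class_of_derivatives _ _ _ _ F) => [s t|[|j] t jm].
- by rewrite subrr normr0 mulr_ge0 ?powR_ge0.
- exact: cC2.
- by rewrite /F/= normr0.
Qed.

(** At distance at most 1 the mean value theorem applies and distance is bounded by
    its power r <= 1; at larger distance the bound on f suffices. *)
Lemma holder_of_bounded_derivative (R : realType) (f df : R -> R) (B r : R) :
  0 <= r <= 1 -> (forall t : R, is_derive t 1 f (df t)) ->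
  (forall t, `|f t| <= B) -> (forall t, `|df t| <= B) ->
  forall s t, `|f s - f t| <= 2 * B * `|s - t| `^ r.
Proof.
move=> /andP[r0 r1] dfE fB dfB.
have B0 : 0 <= B by exact: le_trans (fB 0).
have cf : continuous f.
  move=> t; apply: differentiable_continuous; apply/derivable1_diffP.
  by have := dfE t => dft; exact: ex_derive.
have lip s t : s < t -> `|f t - f s| <= B * `|t - s|.
  move=> st; have [//|u _ ->] := @MVT _ f df s t st (fun x _ => dfE x).
    exact: continuous_subspaceT.
  by rewrite normrM ler_wpM2r.
move=> s t; have [->|st] := eqVneq s t.
  by rewrite !subrr normr0 mulr_ge0 ?powR_ge0// mulr_ge0.
have st0 : 0 < `|s - t| by rewrite normr_gt0 subr_eq0.
have [st1|st1] := leP `|s - t| 1.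
  apply: (@le_trans _ _ (B * `|s - t|)).
    by move: st; rewrite neq_lt => /orP[] /lip//; rewrite distrC [`|t - s|]distrC.
  apply: ler_pM => //; first by lra.
  by apply: ger1_powR; rewrite // st0 st1.
apply: (@le_trans _ _ (2 * B)).
  by rewrite (le_trans (ler_normB _ _))// mulrC mulr_natr mulr2n lerD.
rewrite ler_peMr ?mulr_ge0//.
by rewrite -[leLHS](powRr0 `|s - t|) ler_powR// ltW.
Qed.

Definition bumped_variance (R : realType) (N : nat) (c k x0 h t : R) : R :=
  c + k * bump_der N 0 ((t - x0) / h).

Lemma bump_der0E (R : realType) (N : nat) (t : R) :
  bump_der N 0 t = Num.max 0 (1 - t ^+ 2) ^+ N.
Proof. by rewrite /bump_der subn0/= hornerE mul1r. Qed.

Lemma bump_der0_itv (R : realType) (N : nat) (t : R) :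
  0 <= bump_der N 0 t <= 1.
Proof.
rewrite bump_der0E exprn_ge0 ?le_max ?lexx//= exprn_ile1 ?le_max ?lexx//.
by rewrite ge_max ler01/= lerBlDr lerDl sqr_ge0.
Qed.

(** The j-th derivative of the bump is a h^(gamma - j) times that of the fixed
    profile at (t - x0) / h.  For j <= strict_floor gamma the power of h is at
    most 1, and in the Hoelder estimate of the top derivative the powers of h
    cancel; hence one value of a serves all bandwidths.  The exponent
    [(strict_floor gamma).+2] of the profile is what makes the derivative of the
    top derivative bounded. *)
Lemma bumped_variance_smooth (R : realType) (C1 C2 gamma A : R) :
  0 < C1 -> 0 < C2 -> 1 < gamma -> 0 < A ->
  exists2 a : R, 0 < a <= A & forall x0 h : R, 0 < h <= 1 ->
    smooth_class C1 C2 gamma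
      (bumped_variance (strict_floor gamma).+2 (C2 / 2) (a * h `^ gamma) x0 h).
Proof.
move=> C10 C20 gamma1 A0; have gamma0 : 0 < gamma by lra.
set m := strict_floor gamma; set N := m.+2.
have /andP[mg gm] := strict_floorP gamma0.
have [B B0 bB] := @bump_der_bounded R N m.+1 (ltnSn _).
(* The bounds on a serve the requested cap A, the bounds by C2 on the values and
   the derivatives, and the Hoelder constant C1. *)
pose a := Num.min A (Num.min (C2 / 2 / (1 + B)) (C1 / (2 * B))).
have a0 : 0 < a.
  by rewrite !lt_min A0 !divr_gt0// ?mulr_gt0//; lra.
have aA : a <= A by rewrite ge_min lexx.
have aC2 : a * (1 + B) <= C2 / 2.
  by rewrite -ler_pdivlMr; [rewrite !ge_min lexx orbT|lra].
have aC1 : a * (2 * B) <= C1.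
  by rewrite -ler_pdivlMr; [rewrite !ge_min lexx !orbT|rewrite mulr_gt0].
exists a; first by rewrite a0.
move=> x0 h /andP[h0 h1].
pose F (j : nat) (t : R) := (if j == 0%N then C2 / 2 else 0) +
  a * h `^ (gamma - j%:R) * bump_der N j ((t - x0) / h).
have -> : bumped_variance N (C2 / 2) (a * h `^ gamma) x0 h = F 0%N.
  by apply/funext => t; rewrite /F subr0.
have hle1 j : (j <= m)%N -> 0 <= h `^ (gamma - j%:R) <= 1.
  move=> jm; rewrite powR_ge0/= -[leRHS](powRr0 h) ger_powR ?h0//.
  by rewrite subr_ge0; apply: le_trans (ltW mg); rewrite ler_nat.
have daff (t : R) : is_derive t 1 (fun t : R => (t - x0) / h) h^-1.
  rewrite (_ : (fun t : R => (t - x0) / h) = (id - cst x0) * cst h^-1)//.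
  by apply: is_derive_eq; rewrite /GRing.scale/= mulr0 add0r subr0 mulr1.
apply: smooth_class_of_derivatives => [j t jm|s t|j t jm].
- have jN : (j.+1 < N)%N by rewrite /N !ltnS ltnW.
  have := is_derive_bump ((t - x0) / h) jN => dbump.
  have := @is_derive1_comp _ (bump_der N j) (fun t => (t - x0) / h) t _ _
    dbump (daff t) => dcomp.
  rewrite (_ : F j = cst (if j == 0%N then C2 / 2 else 0) +
     (a * h `^ (gamma - j%:R)) \*: (bump_der N j \o (fun t => (t - x0) / h)))//.
  apply: is_derive_eq; rewrite add0r /F/= add0r /GRing.scale/=.
  have -> : h `^ (gamma - j%:R) = h `^ (gamma - j.+1%:R) * h.
    rewrite -[X in _ = _ * X]powRr1 ?ltW// -powRD; last first.
      by rewrite (gt_eqF h0) implybT.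
    by congr (_ `^ _); rewrite -natr1; ring.
  by field; rewrite gt_eqF.
- pose r := gamma - m%:R.
  have r01 : 0 <= r <= 1.
    by rewrite /r; move: mg gm; rewrite -natr1 /m; lra.
  have mN : (m.+1 < N)%N by [].
  have hol := @holder_of_bounded_derivative R (bump_der N m) (bump_der N m.+1) B r
    r01 (fun t => is_derive_bump t mN) (fun t => bB m t (leqnSn m))
    (fun t => bB m.+1 t (leqnn _)).
  rewrite /F opprD addrACA subrr add0r -mulrBr normrM.
  rewrite ger0_norm; last by rewrite mulr_ge0 ?powR_ge0// ltW.
  have := hol ((s - x0) / h) ((t - x0) / h).
  have -> : (s - x0) / h - (t - x0) / h = (s - t) / h.
    by rewrite -mulrBl; congr (_ * _); ring.
  rewrite normrM powRM// normfV (gtr0_norm h0) => holst.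
  have hr0 : 0 < h `^ r by rewrite powR_gt0.
  have hri : h^-1 `^ r = (h `^ r)^-1.
    by rewrite -powR_inv1 ?ltW// -powRrM mulN1r powRN.
  rewrite hri in holst.
  apply: (le_trans (ler_wpM2l _ holst)); first by rewrite mulr_ge0// ltW.
  rewrite -/m -/r [leLHS](_ : _ = (a * (2 * B)) * `|s - t| `^ r); last first.
    by field; rewrite gt_eqF.
  by rewrite ler_wpM2r ?powR_ge0.
- have /andP[hl hu] := hle1 j (ltnW jm).
  have bj := bB j ((t - x0) / h) (leq_trans (ltnW jm) (leqnSn m)).
  have tail : `|a * h `^ (gamma - j%:R) * bump_der N j ((t - x0) / h)| <= C2 / 2.
    rewrite normrM (normrM a) (gtr0_norm a0) (ger0_norm hl).
    apply: (@le_trans _ _ (a * 1 * B)).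
      apply: ler_pM => //; first by rewrite mulr_ge0// ltW.
      by rewrite ler_wpM2l// ltW.
    by apply: le_trans aC2; rewrite mulr1 ler_wpM2l// ?ltW//; lra.
  rewrite /F (le_trans (ler_normD _ _))//.
  case: ifP => _; first by rewrite gtr0_norm ?divr_gt0//; lra.
  by rewrite normr0 add0r; lra.
Qed.

(** * The rate of convergence *)

(** The larger of two risks is at least half their sum. *)
Lemma minimax_two_point d (T : measurableType d) (R : realType)
    (P : probability T R) (C1 C2 gamma beta : R) (n : nat) (x : 'I_n -> R)
    (eps : 'I_n -> {RV P >-> R}) (x0 c : R) (V : R -> R) :
  mutually_independent eps ->
  (forall i A, measurable A ->
     distribution P (eps i) A = normal_prob 0 1 A) ->
  0 < C1 -> 0 < C2 -> 0 < c ->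
  smooth_class C1 C2 gamma (cst c) -> smooth_class C1 C2 gamma V ->
  (forall t, 0 <= V t) -> \sum_(i < n) (V (x i) / c - 1) ^+ 2 <= 2^-1 ->
  (((V x0 - c) ^+ 2 / 6)%:E <= minimax_risk C1 C2 gamma beta x eps x0)%E.
Proof.
move=> ind eN C10 C20 c0 sc sV V0 chi.
apply: le_ereal_inf_tmp => _ [Vt mVt <-].
set S := ereal_sup _.
have g0 : smooth_class C1 C2 beta (cst 0).
  by apply: smooth_class_cst; rewrite ?normr0 ltW.
have r0S : (pointwise_risk x eps x0 (cst c) (cst 0%R) Vt <= S)%E.
  by apply: ereal_sup_ubound; exists (cst c, cst 0) => //; split => // t _; exact: ltW.
have r1S : (pointwise_risk x eps x0 V (cst 0%R) Vt <= S)%E.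
  by apply: ereal_sup_ubound; exists (V, cst 0).
have := le_trans (two_point_risk x0 ind eN c0 chi mVt) (leeD r0S r1S).
case: S {r0S r1S} => [S| |]; rewrite ?leey//.
by rewrite -EFinD !lee_fin => ?; lra.
Qed.

(** Only design points within distance h of x0 see the bump, and its profile is at
    most 1. *)
Lemma bumped_variance_chi (R : realType) (n : nat) (x : 'I_n -> R) (N : nat)
    (x0 c k h : R) : (0 < N)%N -> 0 < h -> 0 < c ->
  \sum_(i < n) (bumped_variance N c k x0 h (x i) / c - 1) ^+ 2 <=
  #|[pred i : 'I_n | `|x i - x0| <= h]|%:R * (k / c) ^+ 2.
Proof.
move=> N0 h0 c0.
rewrite -sum1_card natr_sum mulr_suml [leRHS]big_mkcond/=.
apply: ler_sum => i _; rewrite mul1r inE.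
have -> : bumped_variance N c k x0 h (x i) / c - 1 =
    k / c * bump_der N 0 ((x i - x0) / h).
  by rewrite /bumped_variance; field; rewrite gt_eqF.
rewrite exprMn; have [_|far] := leP `|x i - x0| h.
  have /andP[b0 b1] := bump_der0_itv N ((x i - x0) / h).
  by rewrite ler_piMr ?sqr_ge0// exprn_ile1.
suff -> : bump_der N 0 ((x i - x0) / h) ^+ 2 = 0 by rewrite mulr0.
rewrite bump_der0E max_l; first by rewrite expr0n gtn_eqF// expr0n.
rewrite subr_le0 -real_normK ?num_real// exprn_ege1//.
by rewrite normrM normfV (gtr0_norm h0) ler_pdivlMr// mul1r ltW.
Qed.

(** The bandwidth solves n h^(2 gamma + 1) = 1, the balance between the
    number of design points under the bump and its squared height. *)
Lemma bandwidth_powers (R : realType) (gamma : R) (n : nat) :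
  0 < gamma -> (0 < n)%N ->
  let h := n%:R `^ (- (2 * gamma + 1)^-1) in
  [/\ 0 < h <= 1, (h `^ gamma) ^+ 2 = n%:R `^ (- (2 * gamma / (2 * gamma + 1))) &
      (1 + n%:R * h) * (h `^ gamma) ^+ 2 <= 2].
Proof.
move=> g0 n0 h; have n1 : 1 <= n%:R :> R by rewrite ler1n.
have d0 : 0 < 2 * gamma + 1 by lra.
have h0 : 0 < h by rewrite powR_gt0// (lt_le_trans _ n1).
have le1 (r : R) : 0 <= r -> n%:R `^ (- r) <= 1 :> R.
  by move=> r0; rewrite -[leRHS](powRr0 n%:R) ler_powR// oppr_le0.
have h2 : (h `^ gamma) ^+ 2 = n%:R `^ (- (2 * gamma / (2 * gamma + 1))).
  rewrite -powR_mulrn ?powR_ge0// -!powRrM; congr (_ `^ _).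
  by field; rewrite gt_eqF.
split=> //; first by rewrite h0 le1// invr_ge0 ltW.
have nh : n%:R * h * (h `^ gamma) ^+ 2 = 1.
  have nN0 : (n%:R != 0 :> R) by rewrite pnatr_eq0 -lt0n.
  rewrite h2 -{1}[n%:R]powRr1 ?ler0n// -!powRD ?nN0 ?implybT//.
  rewrite [X in _ `^ X](_ : _ = 0) ?powRr0//.
  by field; rewrite gt_eqF.
rewrite mulrDl mul1r nh h2; have := le1 (2 * gamma / (2 * gamma + 1)).
by rewrite divr_ge0 ?(ltW d0)// ?mulr_ge0 ?(ltW g0)// => /(_ isT); lra.
Qed.

Theorem theorem4p2 (R : realType) (C1 C2 beta gamma : R)
  (hC1 : 0 < C1) (hC2 : 0 < C2) (hbeta : 0 < beta) (hgamma : 0 < gamma)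
  (x : forall n : nat, 'I_n -> R)
  (hx : forall n : nat, is_design (x n))
  (hgap : (fun n : nat => max_gap (x n)) =O_\oo (fun n : nat => (n%:R : R)^-1))
  (x0 : R) (hx0 : 0 < x0 < 1)
  (hdens : 1 < gamma -> bounded_density_at x x0) :
  exists2 K : R, 0 < K &
    forall n : nat, (0 < n)%N ->
    forall (d : measure_display) (T : measurableType d)
           (P : probability T R) (eps : 'I_n -> {RV P >-> R}),
      mutually_independent eps ->
      (forall (i : 'I_n) (A : set R), measurable A ->
         distribution P (eps i) A = normal_prob 0 1 A) ->
      ((K * n%:R `^ (- (2 * gamma / (2 * gamma + 1))))%:E
         <= minimax_risk C1 C2 gamma beta (x n) eps x0)%E.
Proof.
case: (leP gamma 1) => gamma1.
- have sf0 : strict_floor gamma = 0%N.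
    have /andP[mg _] := strict_floorP hgamma.
    move: mg; case: strict_floor => // k kg.
    by have k1 : 1 <= k.+1%:R :> R; [rewrite ler1n|exfalso; lra].
  exists (1 / 6) => // n n0 d T P eps ind eN.
  (* With this c the relative perturbation 1 / c has square 1 / (4 n), so that the
     n observations contribute 1 / 4 in total. *)
  pose c : R := 2 * Num.sqrt n%:R.
  have n1 : 1 <= n%:R :> R by rewrite ler1n.
  have sn : 0 < Num.sqrt n%:R :> R by rewrite sqrtr_gt0 (lt_le_trans _ n1).
  have c0 : 0 < c by rewrite mulr_gt0.
  have sc v : smooth_class C1 C2 gamma (cst v).
    by apply: smooth_class_cst; rewrite ?sf0// ltW.
  have chi : \sum_(i < n) (cst (c + 1) (x n i) / c - 1) ^+ 2 <= 2^-1.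
    rewrite (eq_bigr (fun=> (4 * n%:R)^-1)) => [|i _].
      rewrite sumr_const card_ord -(mulr_natr (4 * n%:R)^-1).
      have -> : (4 * n%:R)^-1 * n%:R = 4^-1 :> R.
        by field; rewrite gt_eqF// (lt_le_trans _ n1).
      by lra.
    rewrite /cst mulrDl divff ?gt_eqF// addrC addKr mul1r exprVn /c exprMn.
    by rewrite sqr_sqrtr ?ler0n//; congr (_ * _)^-1; ring.
  apply: le_trans
    (minimax_two_point beta x0 ind eN hC1 hC2 c0 (sc c) (sc (c + 1)) _ chi).
    rewrite lee_fin /cst [c + 1]addrC addrK expr1n ler_piMr ?divr_ge0//.
    rewrite -[leRHS](powRr0 n%:R) ler_powR// oppr_le0 divr_ge0//; lra.
  by move=> t; rewrite ltW// addr_gt0.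
- have [D hD] := hdens gamma1.
  pose D' := Num.max 1 D.
  have D1 : 1 <= D' by rewrite le_max lexx.
  have DD : D <= D' by rewrite le_max lexx orbT.
  pose c := C2 / 2; have c0 : 0 < c by rewrite divr_gt0.
  (* The cap on a that makes the sum of squares 2 D' (a / c)^2 at most 1 / 2. *)
  have A0 : 0 < c / (2 * D') by rewrite divr_gt0// mulr_gt0//; lra.
  have [a /andP[a0 aA] smooth_a] := bumped_variance_smooth hC1 hC2 gamma1 A0.
  exists (a ^+ 2 / 6) => [|n n0 d T P eps ind eN].
    by rewrite divr_gt0// exprn_gt0.
  have [] := bandwidth_powers hgamma n0; set h := _ `^ _ => /andP[h0 h1] h2 nh.
  set N := (strict_floor gamma).+2 in smooth_a.
  pose V := bumped_variance N c (a * h `^ gamma) x0 h.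
  have V0 : V x0 - c = a * h `^ gamma.
    rewrite /V /bumped_variance subrr mul0r bump_der0E expr0n/= subr0.
    by rewrite max_r// expr1n mulr1 addrC addKr.
  have Vge0 t : 0 <= V t.
    have /andP[b0 _] := bump_der0_itv N ((t - x0) / h).
    by rewrite addr_ge0 ?(ltW c0)// mulr_ge0// mulr_ge0 ?powR_ge0// ltW.
  have chi : \sum_(i < n) (V (x n i) / c - 1) ^+ 2 <= 2^-1.
    apply: (le_trans (bumped_variance_chi _ _ _ (ltn0Sn _) h0 c0)).
    apply: (@le_trans _ _ (D' * (1 + n%:R * h) * (a * h `^ gamma / c) ^+ 2)).
      rewrite ler_wpM2r ?sqr_ge0// (le_trans (hD n h h0))// ler_wpM2r//.
      by rewrite addr_ge0// mulr_ge0// ltW.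
    have aD : a / c * D' <= 2^-1.
      move: aA; rewrite ler_pdivlMr; last by rewrite mulr_gt0//; lra.
      by rewrite mulrAC ler_pdivrMr//; lra.
    have ac0 : 0 <= a / c by rewrite divr_ge0 ?ltW.
    have -> : D' * (1 + n%:R * h) * (a * h `^ gamma / c) ^+ 2 =
        a / c * (a / c * D') * ((1 + n%:R * h) * (h `^ gamma) ^+ 2).
      by field; rewrite gt_eqF.
    have ac : a / c <= 2^-1 by apply: le_trans aD; rewrite ler_peMr.
    have aacD : a / c * (a / c * D') <= 2^-1 * 2^-1.
      by apply: ler_pM => //; rewrite mulr_ge0//; lra.
    apply: (@le_trans _ _ (2^-1 * 2^-1 * 2)); last by lra.
    apply: ler_pM => //; first by rewrite mulr_ge0// mulr_ge0//; lra.
    by rewrite mulr_ge0 ?sqr_ge0// addr_ge0// mulr_ge0// ltW.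
  have scc : smooth_class C1 C2 gamma (cst c).
    apply: smooth_class_cst => [||_]; [exact: ltW|exact: ltW|].
    by rewrite gtr0_norm// /c; lra.
  have sV : smooth_class C1 C2 gamma V by apply: smooth_a; rewrite h0.
  have := minimax_two_point beta x0 ind eN hC1 hC2 c0 scc sV Vge0 chi.
  by rewrite V0 exprMn h2 mulrAC.
Qed.
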